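(* Let $b\ge 2$ and $n\ge1$. There is a bijection between edge-labeled multigraphs without loops having $n$ edges (labeled $1,\dots,n$) on $b$ vertices, and juggling card sequences $A$ of length $n$ using cards $C_{i,j}$ with $1\le i<j\le b$ in which every one of the $b$ balls is thrown at least once and $\pi_A=\mathrm{id}$.
   Context: There are $b$ balls on levels $1,\dots,b$. For $1\le i<j\le b$ the card $C_{i,j}$ induces the permutation $\pi$ of $[b]$ with $\pi(1)=i$, $\pi(2)=j$, and $\pi$ restricted to $\{3,\dots,b\}$ the order-preserving bijection onto $[b]\setminus\{i,j\}$ (a ball at left level $t$ ends at right level $\pi(t)$); the balls thrown at the card are those at left levels $1$ and $2$ (so two balls are caught and thrown and their relative order is preserved). For $A=C^{(1)}\cdots C^{(n)}$, starting with ball $t$ at level $t$ and passing through the cards left to right, $\pi_A(t)$ is the final level of ball $t$. The multigraphs are counted with unlabeled vertices (up to isomorphism preserving edge labels), with distinct labels $1,\dots,n$ on the edges, parallel edges allowed, no loops, and every vertex incident to at least one edge. *)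

(* Defs.v *)
From HB Require Import structures.
From mathcomp Require Import all_boot all_fingroup.

Set Implicit Arguments.
Unset Strict Implicit.
Unset Printing Implicit Defensive.

Local Open Scope group_scope.

(* Levels, balls and edge labels are numbered from 0: the levels 1, ..., b    *)
(* are the elements 0, ..., b - 1 of 'I_b.                                    *)

Record jcard (b : nat) := JCard {
  jcard_pair : 'I_b * 'I_b;
  jcard_lt : (jcard_pair.1 < jcard_pair.2)%N
}.

HB.instance Definition _ b := [isSub for @jcard_pair b].
HB.instance Definition _ b := [Finite of jcard b by <:].

(* One-line notation of the permutation of C_(i,j): i, j, and then the other  *)
(* levels in increasing order.                                                *)
Definition jcard_word b (c : jcard b) : seq 'I_b :=
  let: (i, j) := jcard_pair c in
  [:: i, j & [seq x <- enum 'I_b | x \notin [:: i; j]]].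

Definition jcard_fun b (c : jcard b) (t : 'I_b) : 'I_b := nth t (jcard_word c) t.

Lemma jcard_word_uniq b (c : jcard b) : uniq (jcard_word c).
Proof.
case: c => [[i j] /= ltij]; rewrite /jcard_word /= filter_uniq ?enum_uniq //.
by rewrite !inE !mem_filter !inE !eqxx orbT andbT /= orbF neq_ltn ltij.
Qed.

Lemma mem_jcard_word b (c : jcard b) : jcard_word c =i 'I_b.
Proof.
case: c => [[i j] ltij] x; rewrite /jcard_word !inE mem_filter mem_enum !inE.
by case: (x == i); case: (x == j).
Qed.

Lemma size_jcard_word b (c : jcard b) : size (jcard_word c) = b.
Proof.
by rewrite -(card_uniqP (jcard_word_uniq c)) (eq_card (mem_jcard_word c)) card_ord.
Qed.

Lemma jcard_fun_inj b (c : jcard b) : injective (jcard_fun c).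
Proof.
move=> s t; rewrite /jcard_fun (set_nth_default t) ?size_jcard_word // => /eqP.
by rewrite nth_uniq ?size_jcard_word ?jcard_word_uniq // => /eqP /val_inj.
Qed.

Definition jcard_perm b (c : jcard b) : 'S_b := perm (@jcard_fun_inj b c).

Lemma jcard_perm0 b (c : jcard b) (t : 'I_b) :
  t = 0 :> nat -> jcard_perm c t = (jcard_pair c).1.
Proof. by rewrite permE /jcard_fun /jcard_word; case: jcard_pair => i j ->. Qed.

Lemma jcard_perm1 b (c : jcard b) (t : 'I_b) :
  t = 1%N :> nat -> jcard_perm c t = (jcard_pair c).2.
Proof. by rewrite permE /jcard_fun /jcard_word; case: jcard_pair => i j ->. Qed.

Lemma jcard_perm_homo b (c : jcard b) (s t : 'I_b) :
  (2 <= s)%N -> (s < t)%N -> (jcard_perm c s < jcard_perm c t)%N.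
Proof.
move=> le2s ltst; have ltsb := ltn_ord s; have lttb := ltn_ord t.
have := size_jcard_word c.
rewrite !permE /jcard_fun /jcard_word; case: jcard_pair => i j /=.
case: (nat_of_ord s) le2s ltst ltsb => [|[|k]] //= _.
case: (nat_of_ord t) lttb => [|[|l]] //= ltlb ltkl ltkb.
set w := filter _ _ => szw.
have w_sorted : sorted (relpre val ltn) w.
  apply: sorted_filter; first by move=> y x z; apply: ltn_trans.
  by rewrite -sorted_map val_enum_ord iota_ltn_sorted.
have szwk : (k < size w)%N by rewrite -2!ltnS szw.
have szwl : (l < size w)%N by rewrite -2!ltnS szw.
rewrite (set_nth_default t s szwk).
apply: (@sorted_ltn_nth _ (relpre val ltn) _ t w w_sorted) => //.
by move=> y x z; apply: ltn_trans.
Qed.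

(* Products in 'S_b act left to right, (s * t) x = t (s x), so the first card *)
(* of the sequence is the first one applied.                                  *)
Definition seq_perm b (A : seq (jcard b)) : 'S_b := \prod_(c <- A) jcard_perm c.

(* The k-th card of A throws ball t: just before that card, after the cards   *)
(* take k A, the ball is on one of the two lowest levels.                     *)
Definition throws b (A : seq (jcard b)) (k : nat) (t : 'I_b) : bool :=
  (seq_perm (take k A) t < 2)%N.

Record juggling_seq (b n : nat) := JugglingSeq {
  jug_cards : n.-tuple (jcard b);
  jugP : [forall t : 'I_b, exists k : 'I_n, throws jug_cards k t]
         && (seq_perm jug_cards == 1)
}.

HB.instance Definition _ b n := [isSub for @jug_cards b n].
HB.instance Definition _ b n := [Finite of juggling_seq b n by <:].

(* The function sends an edge label to the set of endpoints of the edge.      *)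
Record multigraph (b n : nat) := Multigraph {
  mg_edge : {ffun 'I_n -> {set 'I_b}};
  mgP : [forall k, #|mg_edge k| == 2]
        && [forall v, exists k, v \in mg_edge k]
}.

HB.instance Definition _ b n := [isSub for @mg_edge b n].
HB.instance Definition _ b n := [Finite of multigraph b n by <:].

Definition mg_iso b n : rel (multigraph b n) := fun G H =>
  [exists s : 'S_b, [forall k, mg_edge H k == s @: mg_edge G k]].

Lemma mg_isoP b n (G H : multigraph b n) :
  reflect (exists s : 'S_b, forall k, mg_edge H k = s @: mg_edge G k)
          (mg_iso G H).
Proof.
apply: (iffP existsP) => [[s /forallP sP]|[s sP]]; exists s.
  by move=> k; apply/eqP.
by apply/forallP => k; apply/eqP.
Qed.

Lemma mg_iso_refl b n : reflexive (@mg_iso b n).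
Proof.
move=> G; apply/mg_isoP; exists 1 => k.
by rewrite (eq_imset _ (@perm1 _)) imset_id.
Qed.

Lemma mg_iso_sym b n : symmetric (@mg_iso b n).
Proof.
suff sub (G H : multigraph b n) : mg_iso G H -> mg_iso H G.
  by move=> G H; apply/idP/idP; apply: sub.
case/mg_isoP=> s sP; apply/mg_isoP; exists s^-1 => k.
by rewrite sP -imset_comp (eq_imset _ (permK s)) imset_id.
Qed.

Lemma mg_iso_trans b n : transitive (@mg_iso b n).
Proof.
move=> H G K /mg_isoP[s sP] /mg_isoP[t tP]; apply/mg_isoP; exists (s * t) => k.
by rewrite tP sP -imset_comp; apply: eq_imset => x; rewrite /= permM.
Qed.

Canonical mg_iso_equiv b n :=
  EquivRel (@mg_iso b n) (@mg_iso_refl b n) (@mg_iso_sym b n)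
           (@mg_iso_trans b n).

Definition unlabeled_multigraph (b n : nat) : Type :=
  {eq_quot (@mg_iso_equiv b n)}%qT.

(* Main.v *)
(* To a card sequence associate the graph whose k-th edge joins the two balls *)
(* thrown by card k, and read off at each ball the 0/1 sequence of its        *)
(* throws. Since a card keeps the relative order of the two thrown balls and  *)
(* of the other balls, the initial order of the balls is lexicographically    *)
(* decreasing in their throw sequences, with ties broken by the final order.  *)
(* Injectivity: the throw sequences of isomorphic graphs agree up to          *)
(* reindexing, so agree once sorted, and they and the final order determine   *)
(* the cards. Surjectivity: from any final order, run the edges backwards,    *)
(* each bringing its two balls to the front; this map from final to initial   *)
(* orders is idempotent, so an order in its image is preserved, and           *)
(* relabelling the vertices along it gives an identity permutation.           *)

Require Import Defs.
From mathcomp Require Import all_boot all_order all_fingroup zify.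

Set Implicit Arguments.
Unset Strict Implicit.
Unset Printing Implicit Defensive.

Import Order.Theory.

Local Open Scope group_scope.

(** Everything rests on [throw_pattern_lexi]: the starting levels list the throw sequences in weakly
    decreasing lexicographic order, and balls with equal throw sequences never swap. Hence throw
    sequences and final order determine the cards ([throw_pattern_inj]); when the final order is the
    identity, the isomorphism class alone does ([throw_graph_iso_inj]). Conversely, the edges can be
    juggled into any final order ([juggle_edges]), and a second run ending in the start order of the
    first also starts there ([juggle_edges_id]), so every class is reached
    ([throw_graph_iso_surj]). *)

Lemma perm_eq_codom_perm (T : finType) (U : eqType) (f : T -> U) (s : {perm T}) :
  perm_eq (codom (f \o s)) (codom f).
Proof.
rewrite /codom /image_mem map_comp; apply: perm_map; apply: uniq_perm.
- by rewrite map_inj_uniq ?enum_uniq //; apply: perm_inj.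
- exact: enum_uniq.
by move=> x; rewrite mem_enum -[x](permKV s) map_f ?mem_enum.
Qed.

Lemma sorted_codom_ord (b : nat) (T : Type) (r : rel T) (f : 'I_b -> T) :
  (forall u v : 'I_b, u < v -> r (f u) (f v)) -> sorted r (codom f).
Proof.
move=> f_homo; apply: (@homo_sorted _ _ f (relpre val ltn)).
  by move=> u v; apply: f_homo.
by rewrite -sorted_map val_enum_ord iota_ltn_sorted.
Qed.

(** Both families are sorted listings of one multiset, so they coincide. *)
Lemma monotone_reindex (b : nat) (T : eqType) (r : rel T) (f : 'I_b -> T)
    (s : 'S_b) :
    transitive r -> antisymmetric r ->
    (forall u v : 'I_b, u < v -> r (f u) (f v)) ->
    (forall u v : 'I_b, u < v -> r (f (s u)) (f (s v))) ->
  forall u, f (s u) = f u.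
Proof.
move=> r_tr r_asym f_homo fs_homo u.
suff /eq_in_map/(_ u) : codom (f \o s) = codom f by apply; rewrite mem_enum.
apply: (sorted_eq r_tr r_asym); [exact: sorted_codom_ord..|].
exact: perm_eq_codom_perm.
Qed.

Lemma monotone_perm1 (b : nat) (s : 'S_b) :
  (forall u v : 'I_b, u < v -> s u < s v) -> s = 1.
Proof.
move=> s_homo; apply/permP => u; rewrite perm1; apply: val_inj.
apply: (@monotone_reindex b _ leq val) => {u}; [| |by move=> ? ? /ltnW|].
- exact: leq_trans.
- exact: anti_leq.
by move=> u v /s_homo/ltnW.
Qed.

Lemma seq_perm_cons (b : nat) (c : jcard b) A u :
  seq_perm (c :: A) u = seq_perm A (jcard_perm c u).
Proof. by rewrite /seq_perm big_cons permM. Qed.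

(** The type [seqlexi bool] selects the lexicographic order, in which being thrown earlier counts as
    larger. *)
Definition throw_pattern (b : nat) (A : seq (jcard b)) (u : 'I_b) : seqlexi bool :=
  mkseq (throws A ^~ u) (size A).

Lemma throw_pattern_cons (b : nat) (c : jcard b) A u :
  throw_pattern (c :: A) u = (u < 2) :: throw_pattern A (jcard_perm c u).
Proof.
rewrite /throw_pattern /mkseq /= -[1%N]add1n iotaDl -map_comp.
congr (_ :: _); first by rewrite /throws /seq_perm big_nil perm1.
by apply: eq_map => k; rewrite /throws /= seq_perm_cons.
Qed.

Lemma jcard_perm_lt_pair (b : nat) (c : jcard b) (u v : 'I_b) :
  (u < 2) = (v < 2) -> u < v -> jcard_perm c u < jcard_perm c v.
Proof.
case: (ltnP u 2) => [lt2u|le2u _]; last exact: jcard_perm_homo.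
move=> /esym lt2v ltuv.
have u0 : u = 0 :> nat by lia.
have v1 : v = 1%N :> nat by lia.
by rewrite (jcard_perm0 c u0) (jcard_perm1 c v1) jcard_lt.
Qed.

(* Two balls that are always thrown together never swap; otherwise the first  *)
(* card throwing only one of them throws the lower one.                       *)
Lemma throw_pattern_lexi (b : nat) (A : seq (jcard b)) (u v : 'I_b) : u < v ->
  (throw_pattern A v <= throw_pattern A u)%O /\
  (throw_pattern A u = throw_pattern A v -> seq_perm A u < seq_perm A v).
Proof.
elim: A u v => [|c A IH] u v ltuv.
  by split=> // _; rewrite /seq_perm big_nil !perm1.
rewrite !throw_pattern_cons !seq_perm_cons Order.SeqLexiOrder.lexi_cons.
case: (eqVneq (u < 2) (v < 2)) => [eq2|ne2].
  have [le_p lt_p] := IH _ _ (jcard_perm_lt_pair c eq2 ltuv).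
  by split=> [|[_ /lt_p]//]; rewrite eq2 lexx.
have [lt2u ge2v] : (u < 2) /\ (v < 2) = false by move: ne2; lia.
by rewrite lt2u ge2v.
Qed.

(** If [s] inverted a pair, the two lexicographic comparisons would force equal patterns;
    [throw_pattern_lexi] for [B] would then contradict the second hypothesis. *)
Lemma throw_pattern_monotone (b : nat) (A B : seq (jcard b)) (s : 'S_b) :
    (forall u, throw_pattern A u = throw_pattern B (s u)) ->
    (forall u v : 'I_b, u < v -> throw_pattern A u = throw_pattern A v ->
       seq_perm B (s u) < seq_perm B (s v)) ->
  s = 1.
Proof.
move=> eq_pat twins; apply: monotone_perm1 => u v ltuv.
case: (ltngtP (s u) (s v)) => // [ltsvu|/val_inj/perm_inj eq_uv]; last first.
  by rewrite eq_uv ltnn in ltuv.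
have [leA _] := throw_pattern_lexi A ltuv.
have [leB ltB] := throw_pattern_lexi B ltsvu.
have eqA : throw_pattern A u = throw_pattern A v.
  by apply: le_anti; rewrite leA !eq_pat leB.
have := ltn_trans (twins _ _ ltuv eqA) (ltB _).
by rewrite ltnn -!eq_pat; apply.
Qed.

Lemma throw_pattern_rigid (b : nat) (A B : seq (jcard b)) (s : 'S_b) :
    (forall u, throw_pattern A u = throw_pattern B (s u)) ->
    (forall u, seq_perm A u = seq_perm B (s u)) ->
  s = 1.
Proof.
move=> eq_pat eq_perm; apply: (throw_pattern_monotone eq_pat) => u v ltuv.
by rewrite -!eq_perm; case: (throw_pattern_lexi A ltuv).
Qed.

Lemma jcard_perm_inj (b : nat) : 1 < b -> injective (@jcard_perm b).
Proof.
move=> b_gt1 c d eq_cd; have b_gt0 := ltnW b_gt1.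
apply: val_inj; rewrite /= [LHS]surjective_pairing [RHS]surjective_pairing.
rewrite -!(@jcard_perm0 _ _ (Ordinal b_gt0)) //.
by rewrite -!(@jcard_perm1 _ _ (Ordinal b_gt1)) // eq_cd.
Qed.

Lemma throw_pattern_inj (b : nat) (A B : seq (jcard b)) :
    1 < b -> size A = size B ->
    throw_pattern A =1 throw_pattern B -> seq_perm A = seq_perm B ->
  A = B.
Proof.
(* The reindexing [s] makes the induction go through: once the first cards are removed, the tails
   agree only up to a permutation, which rigidity shows to be trivial. *)
move=> b_gt1; suff main (s : 'S_b) : size A = size B ->
    (forall u, throw_pattern A u = throw_pattern B (s u)) ->
    (forall u, seq_perm A u = seq_perm B (s u)) -> A = B.
  move=> eq_sz eq_pat eq_perm; apply: (main 1) => // u; rewrite perm1 //.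
  by rewrite eq_perm.
elim: A B s => [|c A IH] [|d B] //= s [eq_sz] eq_pat eq_perm.
have s1 := throw_pattern_rigid eq_pat eq_perm.
pose s' := (jcard_perm c)^-1 * jcard_perm d.
have pat' u : throw_pattern A u = throw_pattern B (s' u).
  have := eq_pat ((jcard_perm c)^-1 u).
  by rewrite s1 perm1 !throw_pattern_cons permKV permM => -[].
have perm' u : seq_perm A u = seq_perm B (s' u).
  have := eq_perm ((jcard_perm c)^-1 u).
  by rewrite s1 perm1 !seq_perm_cons permKV permM.
have s'1 := throw_pattern_rigid pat' perm'.
rewrite (IH B s' eq_sz pat' perm'); congr (_ :: _).
apply: (jcard_perm_inj b_gt1); apply/eqP; rewrite eq_mulVg1.
exact/eqP/s'1.
Qed.

Lemma jcard_of_set (b : nat) (e : {set 'I_b}) : #|e| = 2 ->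
  exists c : jcard b, forall u : 'I_b, (u < 2) = (jcard_perm c u \in e).
Proof.
move=> /eqP/cards2P[x [y [neq_xy ->]]] {e}.
wlog ltxy : x y neq_xy / x < y.
  move=> IH; case: (ltngtP x y) => [/IH|ltyx|/val_inj eq_xy]; first exact.
    by rewrite setUC; apply: IH => //; rewrite eq_sym.
  by rewrite eq_xy eqxx in neq_xy.
have b_gt1 : 1 < b by apply: leq_ltn_trans (ltn_ord y); apply: leq_ltn_trans ltxy.
pose c := @JCard b (x, y) ltxy; exists c => u.
have -> : x = jcard_perm c (Ordinal (ltnW b_gt1)) by rewrite jcard_perm0.
have -> : y = jcard_perm c (Ordinal b_gt1) by rewrite jcard_perm1.
by rewrite !inE !(inj_eq perm_inj) -!val_eqE /=; case: (val u) => [|[|]].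
Qed.

Lemma juggle_edges (b : nat) (E : seq {set 'I_b}) (tau : 'S_b) :
    all (fun e : {set 'I_b} => #|e| == 2) E ->
  exists A : seq (jcard b), exists2 s : 'S_b,
    forall u, throw_pattern A (s u) = [seq u \in (e : {set 'I_b}) | e <- E] &
    forall u, seq_perm A (s u) = tau u.
Proof.
elim: E => [|e E IH] /=.
  by exists [::], tau => // u; rewrite /seq_perm big_nil perm1.
case/andP=> /eqP card_e /IH[A [s patA permA]].
have [|c cP] := @jcard_of_set b (s @: e); first by rewrite card_imset //; apply: perm_inj.
(* Built backwards: [s] gives the levels just after the new card, so they are pulled back through
   it. *)
exists (c :: A), (s * (jcard_perm c)^-1) => u.
  rewrite throw_pattern_cons permM permKV patA cP permKV mem_imset //.
  exact: perm_inj.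
by rewrite seq_perm_cons permM permKV permA.
Qed.

(* Juggling the edges a second time, from the order reached the first time,   *)
(* reproduces that order.                                                     *)
Lemma juggle_edges_id (b : nat) (E : seq {set 'I_b}) :
    all (fun e : {set 'I_b} => #|e| == 2) E ->
  exists A : seq (jcard b), exists2 s : 'S_b,
    forall u, throw_pattern A (s u) = [seq u \in (e : {set 'I_b}) | e <- E] &
    seq_perm A = 1.
Proof.
move=> cardE; have [A1 [s1 pat1 perm1']] := juggle_edges 1 cardE.
have [A2 [s2 pat2 perm2]] := juggle_edges s1 cardE.
(* The run [A2] takes [(s1^-1 * s2) u] to [u], so balls with equal patterns keep their order. *)
have s12 : s1^-1 * s2 = 1.
  apply: (@throw_pattern_monotone _ A1 A2) => [u|u v ltuv _].
    by rewrite permM pat2 -pat1 permKV.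
  by rewrite !permM !perm2 !permKV.
exists A2, s2 => //; apply/permP => u.
have /eqP := s12; rewrite -eq_mulVg1 => /eqP eq_s.
by rewrite -[u](permKV s2) perm2 perm1 eq_s.
Qed.

Lemma nth_throw_pattern (b : nat) (A : seq (jcard b)) u k :
  k < size A -> nth false (throw_pattern A u) k = throws A k u.
Proof. exact: nth_mkseq. Qed.

Section ThrowGraph.

Variables (b n : nat) (b_gt1 : 1 < b).

Lemma throw_graph_subproof (A : juggling_seq b n) :
  let E := [ffun k : 'I_n => [set t | throws (jug_cards A) k t]] in
  [forall k, #|E k| == 2] && [forall v, exists k, v \in E k].
Proof.
case: A => A /= /andP[/forallP coverA _].
apply/andP; split; apply/forallP => k; last first.
  by have /existsP[j jP] := coverA k; apply/existsP; exists j; rewrite ffunE inE.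
rewrite ffunE; pose s := seq_perm (take k A).
have -> : [set t | throws A k t] = s @^-1: [set t : 'I_b | t < 2].
  by apply/setP => t; rewrite !inE.
rewrite card_preimset; last exact: perm_inj.
have -> : [set t : 'I_b | t < 2] = [set Ordinal (ltnW b_gt1); Ordinal b_gt1].
  by apply/setP => t; rewrite !inE -!val_eqE /=; case: (val t) => [|[|]].
by rewrite cards2.
Qed.

Definition throw_graph (A : juggling_seq b n) : multigraph b n :=
  Multigraph (throw_graph_subproof A).

Lemma throw_graph_iso_inj (A B : juggling_seq b n) :
  mg_iso (throw_graph A) (throw_graph B) -> A = B.
Proof.
case/mg_isoP=> s sP.
have eq_pat u : throw_pattern (jug_cards A) u = throw_pattern (jug_cards B) (s u).
  apply: (@eq_from_nth _ false) => [|k]; first by rewrite !size_mkseq !size_tuple.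
  rewrite size_mkseq size_tuple => ltkn; rewrite !nth_throw_pattern ?size_tuple //.
  have /setP/(_ (s u)) := sP (Ordinal ltkn).
  by rewrite !ffunE inE mem_imset ?inE //; apply: perm_inj.
case: A B eq_pat {sP} => [A /= PA] [B /= PB] eq_pat.
have /andP[_ /eqP A1] := PA; have /andP[_ /eqP B1] := PB.
apply: val_inj; apply: val_inj => /=.
apply: (throw_pattern_inj b_gt1); rewrite ?size_tuple ?A1 ?B1 // => u.
(* Patterns decrease with the level both for [B] and, through [s], for [A]. *)
rewrite eq_pat; apply: (@monotone_reindex b _ (fun x y => (y <= x)%O)).
- by move=> y x z leyx lezy; apply: le_trans leyx.
- by move=> x y; rewrite andbC; apply: le_anti.
- by move=> v w /(throw_pattern_lexi B)[].
by move=> v w /(throw_pattern_lexi A)[]; rewrite !eq_pat.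
Qed.

Lemma throw_graph_iso_surj (G : multigraph b n) :
  exists A : juggling_seq b n, mg_iso (throw_graph A) G.
Proof.
case: G => E PE; have /andP[/forallP cardE /forallP coverE] := PE.
have [|A [s patA A1]] := @juggle_edges_id b [seq E k | k <- enum 'I_n].
  by apply/allP => _ /mapP[k _ ->]; apply: cardE.
have szA : size A == n.
  have := congr1 size (patA (Ordinal b_gt1)).
  by rewrite size_mkseq 2!size_map size_enum_ord => ->.
have throwsA (k : 'I_n) u : throws A k (s u) = (u \in E k).
  rewrite -nth_throw_pattern ?(eqP szA) ?patA //.
  by rewrite -map_comp (nth_map k) ?size_enum_ord // nth_ord_enum.
have PA : [forall t : 'I_b, exists k : 'I_n, throws (Tuple szA) k t]
          && (seq_perm (Tuple szA) == 1).
  rewrite A1 eqxx andbT; apply/forallP => t.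
  have /existsP[k kP] := coverE ((s^-1) t).
  by apply/existsP; exists k; rewrite -[t](permKV s) throwsA.
(* Vertex [u] became the ball starting at level [s u], so the isomorphism back is [s^-1]. *)
exists (JugglingSeq PA); apply/mg_isoP; exists s^-1 => k /=.
apply/setP => u; rewrite -[u](permK s) mem_imset; last exact: perm_inj.
by rewrite permK ffunE inE throwsA.
Qed.

End ThrowGraph.

Theorem theorem3p1 (b n : nat) (hb : (2 <= b)%N) (hn : (1 <= n)%N) :
  exists f : unlabeled_multigraph b n -> juggling_seq b n, bijective f.
Proof.
(* The natural map goes from card sequences to classes of graphs; [f] is its inverse, obtained by
   choosing preimages. *)
pose g (A : juggling_seq b n) : unlabeled_multigraph b n :=
  \pi_({eq_quot (@mg_iso_equiv b n)})%qT (throw_graph hb A).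
have g_inj : injective g.
  by move=> A B /eqmodP/throw_graph_iso_inj.
have g_surj q : exists A, g A == q.
  elim/quotW: q => G; have [A isoA] := throw_graph_iso_surj hb G.
  by exists A; apply/eqP/eqmodP.
pose f q := xchoose (g_surj q).
have fK : cancel f g by move=> q; apply/eqP/(xchooseP (g_surj q)).
by exists f, g => // A; apply: g_inj; rewrite fK.
Qed.
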